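(* Let $\gamma,\tau$ be $(p,q)$-clans with $\gamma<\tau$ in the combinatorial Bruhat order. Then there exists a $(p,q)$-clan $\gamma'$ with $\gamma<\gamma'\le\tau$ such that $\gamma'$ is obtained from $\gamma=c_1\cdots c_n$ by one of the following moves, where all positions $i<j<k<l$ are not necessarily adjacent and all other characters are unchanged: (1) $c_i=+$, $c_j=-$ are replaced by a new matching pair of natural numbers ($+-\to 11$); (2) $c_i=-$, $c_j=+$ are replaced by a new matching pair ($-+\to 11$); (3) $c_i=c_j\in\mathbb{N}$ a pair and $c_k=+$: replace by $c_i=c_k$ a pair and $c_j=+$ ($11+\to 1+1$); (4) $c_i=c_j\in\mathbb{N}$ a pair and $c_k=-$: replace by $c_i=c_k$ a pair and $c_j=-$ ($11-\to 1-1$); (5) $c_i=+$ and $c_j=c_k\in\mathbb{N}$ a pair: replace by $c_i=c_k$ a pair and $c_j=+$ ($+11\to 1+1$); (6) $c_i=-$ and $c_j=c_k\in\mathbb{N}$ a pair: replace by $c_i=c_k$ a pair and $c_j=-$ ($-11\to 1-1$); (7) $c_i=c_j$ and $c_k=c_l$ pairs: replace by pairs $c_i=c_k$ and $c_j=c_l$ ($1122\to 1212$); (8) $c_i=c_j$ and $c_k=c_l$ pairs: replace by a pair $c_i=c_l$ with $c_j=+$, $c_k=-$ ($1122\to 1+-1$); (9) $c_i=c_j$ and $c_k=c_l$ pairs: replace by a pair $c_i=c_l$ with $c_j=-$, $c_k=+$ ($1122\to 1-+1$); (10) $c_i=c_k$ and $c_j=c_l$ pairs: replace by pairs $c_i=c_l$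 and $c_j=c_k$ ($1212\to 1221$).
   Context: $n=p+q$. A $(p,q)$-clan is an involution of $\{1,\dots,n\}$ with each fixed point decorated by $+$ or $-$, such that (number of $+$) $-$ (number of $-$) $=p-q$; written as $c_1\cdots c_n$ with $c_i$ the sign of a fixed point $i$ and $c_i=c_j\in\mathbb{N}$ for each swapped pair $\{i,j\}$ (distinct numbers for distinct pairs). $\gamma(i;+)$ (resp. $\gamma(i;-)$) is the number of $+$ (resp. $-$) signs plus the number of pairs of equal natural numbers with both entries among $c_1\cdots c_i$; for $i<j$, $\gamma(i;j)$ is the number of pairs $c_s=c_t\in\mathbb{N}$ with $s\le i<j<t$. The combinatorial Bruhat order: $\gamma\le\tau$ iff $\gamma(i;+)\ge\tau(i;+)$ and $\gamma(i;-)\ge\tau(i;-)$ for all $i$, and $\gamma(i;j)\le\tau(i;j)$ for all $i<j$; $\gamma<\tau$ means $\gamma\le\tau$ and $\gamma\ne\tau$. *)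

(* Defs.v *)
From HB Require Import structures.
From mathcomp Require Import all_boot all_order all_algebra.
Set Implicit Arguments.
Unset Strict Implicit.
Unset Printing Implicit Defensive.

(* Positions 1, ..., n are represented by the ordinals
   0, ..., n.-1 of 'I_n.  Signs are booleans, written sP (+) and sM (-). *)
Notation sP := true (only parsing).
Notation sM := false (only parsing).

(* A map of positions together with a partial decoration by signs. *)
Definition preclan (n : nat) : Type :=
  ({ffun 'I_n -> 'I_n} * {ffun 'I_n -> option bool})%type.

Definition mate n (c : preclan n) : {ffun 'I_n -> 'I_n} := c.1.
Definition sgn n (c : preclan n) : {ffun 'I_n -> option bool} := c.2.

(* The middle clause says that exactly the fixed points carry a sign; with
   no junk decoration on the swapped positions, Leibniz equality of clans is
   equality of words up to renaming of the natural numbers. *)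
Definition is_clan (p q : nat) (c : preclan (p + q)) : bool :=
  [&& [forall i, mate c (mate c i) == i],
      [forall i, isSome (sgn c i) == (mate c i == i)]
    & (#|[set i | sgn c i == Some sP]|%:Z - #|[set i | sgn c i == Some sM]|%:Z
         == p%:Z - q%:Z)%R].

Record clan (p q : nat) : Type :=
  Clan { clan_val :> preclan (p + q); clan_valP : is_clan clan_val }.

HB.instance Definition _ p q := [isSub for @clan_val p q].
HB.instance Definition _ p q := [Finite of clan p q by <:].

(* gamma(i;+) is sign_rank gamma sP i, gamma(i;-) is sign_rank gamma sM i;
   a pair {s, t} is counted once, as the ordered pair with s < t. *)
Definition sign_rank n (c : preclan n) (e : bool) (i : 'I_n) : nat :=
  #|[set s : 'I_n | (s <= i) && (sgn c s == Some e)]|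
  + #|[set st : 'I_n * 'I_n |
        (st.1 < st.2) && (st.2 <= i) && (mate c st.1 == st.2)]|.

(* gamma(i;j) *)
Definition pair_rank n (c : preclan n) (i j : 'I_n) : nat :=
  #|[set st : 'I_n * 'I_n |
      (st.1 <= i) && (j < st.2) && (mate c st.1 == st.2)]|.

Definition bruhat_le n (c d : preclan n) : Prop :=
  [/\ forall i : 'I_n, sign_rank d sP i <= sign_rank c sP i,
      forall i : 'I_n, sign_rank d sM i <= sign_rank c sM i
    & forall i j : 'I_n, i < j -> pair_rank c i j <= pair_rank d i j].

Definition bruhat_lt p q (c d : clan p q) : Prop := bruhat_le c d /\ c <> d.

(* Characters outside the listed positions are unchanged; for a natural
   number this means that the position keeps its mate. *)
Definition same_off n (A : seq 'I_n) (c d : preclan n) : Prop :=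
  forall x, x \notin A -> mate d x = mate c x /\ sgn d x = sgn c x.

Definition has_sign n (c : preclan n) (i : 'I_n) (e : bool) : Prop :=
  sgn c i = Some e.

(* c_i = c_j is a natural number *)
Definition matched n (c : preclan n) (i j : 'I_n) : Prop :=
  i <> j /\ mate c i = j.

Inductive clan_move n (c d : preclan n) : Prop :=
| Move_pm_11 (i j : 'I_n) of
    i < j & same_off [:: i; j] c d &
    has_sign c i sP & has_sign c j sM & matched d i j
| Move_mp_11 (i j : 'I_n) of
    i < j & same_off [:: i; j] c d &
    has_sign c i sM & has_sign c j sP & matched d i j
| Move_11p_1p1 (i j k : 'I_n) of
    i < j & j < k & same_off [:: i; j; k] c d &
    matched c i j & has_sign c k sP & matched d i k & has_sign d j sP
| Move_11m_1m1 (i j k : 'I_n) of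
    i < j & j < k & same_off [:: i; j; k] c d &
    matched c i j & has_sign c k sM & matched d i k & has_sign d j sM
| Move_p11_1p1 (i j k : 'I_n) of
    i < j & j < k & same_off [:: i; j; k] c d &
    has_sign c i sP & matched c j k & matched d i k & has_sign d j sP
| Move_m11_1m1 (i j k : 'I_n) of
    i < j & j < k & same_off [:: i; j; k] c d &
    has_sign c i sM & matched c j k & matched d i k & has_sign d j sM
| Move_1122_1212 (i j k l : 'I_n) of
    i < j & j < k & k < l & same_off [:: i; j; k; l] c d &
    matched c i j & matched c k l & matched d i k & matched d j l
| Move_1122_1pm1 (i j k l : 'I_n) of
    i < j & j < k & k < l & same_off [:: i; j; k; l] c d &
    matched c i j & matched c k l &
    matched d i l & has_sign d j sP & has_sign d k sM
| Move_1122_1mp1 (i j k l : 'I_n) of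
    i < j & j < k & k < l & same_off [:: i; j; k; l] c d &
    matched c i j & matched c k l &
    matched d i l & has_sign d j sM & has_sign d k sP
| Move_1212_1221 (i j k l : 'I_n) of
    i < j & j < k & k < l & same_off [:: i; j; k; l] c d &
    matched c i k & matched c j l & matched d i l & matched d j k.

(* Main.v *)
Require Import Defs.
From mathcomp Require Import all_boot all_order all_algebra.
From mathcomp Require Import zify.
Set Implicit Arguments.
Unset Strict Implicit.
Unset Printing Implicit Defensive.

(** Let [m] be the first position where the words of [c = gamma] and [t = tau]
differ, either by their character type or because they close different pairs
there.  The order forces [c] to have a sign and [t] an opening at [m], or [c]
to close a pair [(i, m)] while [t] does anything else; if [t] closes another
pair, a move 1212 -> 1221 works.  In the remaining cases the order inequalities
[c(a;b) <= t(a;b)] become strict ("slack") for [a, b] just after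
[m].  Let the slack persist up to a maximal level [Y] and let [k] be the first
position between [m] and [Y] where [c] has a suitable sign or opens a pair
closing by [Y].  Every pair that [c] opens before [k] closes after [Y], so the
equality at [Y] propagates the slack to all [(a, b)] affected by the move
joining [m] (or [i]) to [k], and also gives the needed strictness for signs.
If there were no such [k], counting closings between [m] and [Y] would violate
the order at [Y]. *)

(** * Rank functions *)

Definition wf n (c : preclan n) : Prop :=
  (forall x, mate c (mate c x) = x) /\
  (forall x, isSome (sgn c x) = (mate c x == x)).

(* Bounds are exclusive: gamma(i;j) is [npairs gamma i.+1 j.+1], and
   gamma(i;e) is [nsigns gamma e i.+1].  Unlike [pair_rank], [npairs] is also
   used with equal bounds. *)
Definition npairs n (c : preclan n) (a b : nat) : nat :=
  \sum_(s < n) ((s < a) && (b <= mate c s)).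

Definition nsigns n (c : preclan n) (e : bool) (a : nat) : nat :=
  \sum_(s < n) ((s < a) && ((sgn c s == Some e) || (mate c s < s))).

Section Ranks.
Variables (n : nat) (c : preclan n).

Lemma sum_ltnS (F : 'I_n -> bool) (x : 'I_n) :
  \sum_(s < n) ((s < x.+1) && F s) = \sum_(s < n) ((s < x) && F s) + F x.
Proof.
rewrite (bigD1 x) //= [in RHS](bigD1 x) //= ltnSn ltnn /= addnC add0n.
congr (_ + _); apply: eq_bigr => s /negPf sx.
by rewrite ltnS leq_eqVlt -val_eqE /= in sx *; rewrite sx.
Qed.

Lemma npairsS (x : 'I_n) b : npairs c x.+1 b = npairs c x b + (b <= mate c x).
Proof. exact: sum_ltnS. Qed.

Lemma nsignsS e (x : 'I_n) :
  nsigns c e x.+1 = nsigns c e x + ((sgn c x == Some e) || (mate c x < x)).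
Proof. exact: sum_ltnS. Qed.

Lemma npairs0 b : npairs c 0 b = 0.
Proof. by rewrite /npairs big1. Qed.

Lemma nsigns0 e : nsigns c e 0 = 0.
Proof. by rewrite /nsigns big1. Qed.

Lemma npairs_size a b : n <= b -> npairs c a b = 0.
Proof.
move=> nb; rewrite /npairs big1 // => s _.
by rewrite [b <= _]leqNgt (leq_trans (ltn_ord _) nb) andbF.
Qed.

Lemma nsigns_size e a : n <= a -> nsigns c e a = nsigns c e n.
Proof.
move=> na; apply: eq_bigr => s _.
by rewrite ltn_ord (leq_trans (ltn_ord s) na).
Qed.

Hypothesis cwf : wf c.

Lemma wfK x : mate c (mate c x) = x.
Proof. by case: cwf. Qed.

(** Raising the lower bound past [x] loses exactly one candidate, the partner of [x]. *)
Lemma npairs_mate a (x : 'I_n) : npairs c a x = npairs c a x.+1 + (mate c x < a).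
Proof.
rewrite /npairs (bigD1 (mate c x)) //= [in RHS](bigD1 (mate c x)) //= wfK leqnn ltnn.
rewrite andbT andbF add0n addnC; congr (_ + _); apply: eq_bigr => s /eqP sx.
congr (nat_of_bool (_ && _)); rewrite leq_eqVlt; case: eqP => // /val_inj e.
by case: sx; rewrite e wfK.
Qed.

Lemma sgnP (x : 'I_n) :
  [\/ exists e, sgn c x = Some e /\ mate c x = x,
      sgn c x = None /\ x < mate c x | sgn c x = None /\ mate c x < x].
Proof.
case: cwf => _ /(_ x); case: (ltngtP x (mate c x)) => h.
- case: (sgn c x) => [e|_]; last by constructor 2.
  by move/esym/eqP => e1; move: h; rewrite e1 ltnn.
- case: (sgn c x) => [e|_]; last by constructor 3.
  by move/esym/eqP => e1; move: h; rewrite e1 ltnn.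
- move/val_inj: h => <-; rewrite eqxx.
  by case: (sgn c x) => // e _; constructor 1; exists e.
Qed.

(** Each position adds one to the left side: a sign enters its own count, an opening adds a pending
    pair, and a closing enters both sign counts while removing a pending pair. *)
Lemma count_add a : a <= n -> nsigns c true a + nsigns c false a + npairs c a a = a.
Proof.
elim: a => [|a IH] an; first by rewrite !nsigns0 npairs0.
have {}IH := IH (ltnW an).
have := npairs_mate a (Ordinal an); have := npairsS (Ordinal an) a.+1.
have := nsignsS true (Ordinal an); have := nsignsS false (Ordinal an).
case: (sgnP (Ordinal an)) => [[[] [-> ->]]|[-> h]|[-> h]];
  try move: h => /=; rewrite /= ?ltnn /=; lia.
Qed.

(** A pair lies within a prefix iff its right end does, so pairs are counted by their closing
    positions. *)
Lemma sign_rankE e (x : 'I_n) : sign_rank c e x = nsigns c e x.+1.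
Proof.
rewrite /sign_rank /nsigns.
have -> : [set st : 'I_n * 'I_n |
        (st.1 < st.2) && (st.2 <= x) && (mate c st.1 == st.2)] =
  [set (mate c t, t) | t in [set t : 'I_n | (t <= x) && (mate c t < t)]].
  apply/setP=> -[s t]; rewrite inE /=; apply/idP/imsetP.
    case/andP=> /andP[st tx] /eqP mst; exists t; last by rewrite -mst wfK.
    by rewrite inE tx -mst wfK mst.
  by case=> t'; rewrite inE => /andP[h1 h2] [-> ->]; rewrite h1 h2 wfK eqxx.
rewrite card_in_imset; last by move=> t t' _ _ [].
rewrite -!sum1_card big_mkcond [X in _ + X]big_mkcond -big_split /=; apply: eq_bigr => s _.
rewrite !inE ltnS; case: (s <= x) => //=.
case: (sgnP s) => [[e' [-> ->]]|[-> h]|[-> h]] /=; rewrite ?ltnn ?orbF.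
- by case: ifP.
- by rewrite ltnNge (ltnW h).
- by rewrite h.
Qed.

Lemma pair_rankE (x y : 'I_n) : pair_rank c x y = npairs c x.+1 y.+1.
Proof.
rewrite /pair_rank /npairs.
have -> : [set st : 'I_n * 'I_n |
        (st.1 <= x) && (y < st.2) && (mate c st.1 == st.2)] =
  [set (s, mate c s) | s in [set s : 'I_n | (s <= x) && (y < mate c s)]].
  apply/setP=> -[s t]; rewrite inE /=; apply/idP/imsetP.
    by case/andP=> /andP[st tx] /eqP mst; exists s; rewrite ?inE ?mst ?st.
  by case=> s'; rewrite inE => /andP[h1 h2] [-> ->]; rewrite h1 h2 eqxx.
rewrite card_in_imset; last by move=> t t' _ _ [].
rewrite -sum1_card big_mkcond /=; apply: eq_bigr => s _.
by rewrite !inE ltnS; case: ifP.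
Qed.

(** * Growth of the rank functions along an interval *)

Lemma npairs_le_mono a0 a b Y : a0 <= a -> b <= Y ->
  (forall x : 'I_n, a0 <= x < a -> b <= mate c x -> Y <= mate c x) ->
  a <= n -> npairs c a b + npairs c a0 Y <= npairs c a0 b + npairs c a Y.
Proof.
move=> h bY H an; elim: a h H an => [|a IH] h H an; first by have -> : a0 = 0 by lia.
case: (ltngtP a0 a.+1) h => // [h|<-] _; last by lia.
have := IH h (fun x xa => H x ltac:(lia)) (ltnW an).
have := H (Ordinal an); have := npairsS (Ordinal an) b.
have := npairsS (Ordinal an) Y => /=; lia.
Qed.

(** A position whose mate reaches [Y] also reaches [b], so the growth at [Y] is at most that at [b].
    In [npairs_le_mono] the reverse holds because no mate lands in [[b, Y)]. *)
Lemma npairs_ge_mono a0 a b Y : a0 <= a -> b <= Y -> a <= n ->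
  npairs c a0 b + npairs c a Y <= npairs c a b + npairs c a0 Y.
Proof.
move=> h bY an; elim: a h an => [|a IH] h an; first by have -> : a0 = 0 by lia.
case: (ltngtP a0 a.+1) h => // [h|<-] _; last by lia.
have := IH h (ltnW an); have := npairsS (Ordinal an) b.
have := npairsS (Ordinal an) Y => /=; lia.
Qed.

(** Every position in [[M, a)] is counted: signs [f] and closings by [nsigns], openings by [npairs]
    since they reach [Y]. *)
Lemma count_growth_ge f M a Y : M <= a -> a <= n ->
  (forall x : 'I_n, M <= x < a -> sgn c x != Some (~~ f)) ->
  (forall x : 'I_n, M <= x < a -> x < mate c x -> Y <= mate c x) ->
  nsigns c f M + npairs c M Y + (a - M) <= nsigns c f a + npairs c a Y.
Proof.
move=> h an H1 H2; elim: a h an H1 H2 => [|a IH] h an H1 H2.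
  by rewrite (_ : M = 0) ?addn0 //; lia.
case: (ltngtP M a.+1) h => // [h|<-] _; last by lia.
have := IH h (ltnW an) (fun x xa => H1 x ltac:(lia)) (fun x xa => H2 x ltac:(lia)).
have := H1 (Ordinal an) ltac:(rewrite /=; lia).
have := H2 (Ordinal an) ltac:(rewrite /=; lia).
have := npairsS (Ordinal an) Y; have := nsignsS f (Ordinal an).
case: (sgnP (Ordinal an)) => [[e [-> ->]]|[-> k]|[-> k]] /=; try (move: k => /=; lia).
by case: e; case: f {IH H1 H2} => //=; lia.
Qed.

(** No position is counted twice: as [a <= Y], only openings can reach [Y], and [nsigns] ignores
    openings. *)
Lemma count_growth_le f M a Y : M <= a -> a <= n -> a <= Y ->
  nsigns c f a + npairs c a Y <= nsigns c f M + npairs c M Y + (a - M).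
Proof.
move=> h an aY; elim: a h an aY => [|a IH] h an aY.
  by rewrite (_ : M = 0) ?addn0 //; lia.
case: (ltngtP M a.+1) h => // [h|<-] _; last by lia.
have := IH h (ltnW an) (ltnW aY).
have := npairsS (Ordinal an) Y; have := nsignsS f (Ordinal an).
case: (sgnP (Ordinal an)) => [[e [-> ->]]|[-> k]|[-> k]] /=; try (move: k => /=; lia).
by lia.
Qed.

(** With no sign [f] and no pair inside [[M, z)], the count for [f] rises only at closings of pairs
    opened before [M], and each of these removes one pair from [npairs c M]. *)
Lemma nsigns_closing_le f M z : M <= z -> z <= n ->
  (forall x : 'I_n, M <= x < z -> sgn c x != Some f) ->
  (forall x : 'I_n, M <= x < z -> x < mate c x -> z <= mate c x) ->
  nsigns c f z + npairs c M z <= nsigns c f M + npairs c M M.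
Proof.
move=> h zn H1 H2.
suff : forall a, M <= a -> a <= z -> nsigns c f a + npairs c M a <= nsigns c f M + npairs c M M.
  by apply.
elim=> [|a IH] Ma az; first by have -> : M = 0 by lia.
case: (ltngtP M a.+1) Ma => // [Ma|<-] _; last by lia.
have an : a < n by lia.
have := IH ltac:(lia) ltac:(lia).
have := H1 (Ordinal an) ltac:(rewrite /=; lia).
have := npairs_mate M (Ordinal an); have := nsignsS f (Ordinal an).
have := H2 (mate c (Ordinal an)); rewrite wfK.
case: (sgnP (Ordinal an)) => [[e [-> ->]]|[-> k]|[-> k]] /=; try (move: k => /=; lia).
by case: e; case: f {IH H1 H2} => //=; lia.
Qed.

Lemma nsigns_closing_ge f M z : M <= z -> z <= n ->
  nsigns c f M + npairs c M M <= nsigns c f z + npairs c M z.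
Proof.
elim: z => [|a IH] Ma an; first by have -> : M = 0 by lia.
case: (ltngtP M a.+1) Ma => // [Ma|<-] _; last by lia.
have := IH ltac:(lia) ltac:(lia).
have := npairs_mate M (Ordinal an); have := nsignsS f (Ordinal an) => /=.
by case: (_ || _) (@orbT (sgn c (Ordinal an) == Some f)) => /=; lia.
Qed.

End Ranks.

(** * The Bruhat order in terms of the rank functions *)

(* [count_add] makes the case [a = b] a consequence of the sign inequalities. *)
Definition rank_le n (c d : preclan n) : Prop :=
  (forall a b, a <= b -> npairs c a b <= npairs d a b) /\
  (forall e a, nsigns d e a <= nsigns c e a).

(** The ordinal pair ranks cover [1 <= a < b <= n]. Off the diagonal, [npairs] vanishes outside this
    range, and [nsigns] is constant beyond [n]. *)
Lemma bruhat_leE n (c d : preclan n) : wf c -> wf d ->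
  bruhat_le c d <-> rank_le c d.
Proof.
move=> cwf dwf; split=> [[lep lem leo]|[leo les]].
  have les e a : nsigns d e a <= nsigns c e a.
    have small k : k <= n -> nsigns d e k <= nsigns c e k.
      case: k => [|k] kn; first by rewrite !nsigns0.
      have := lep (Ordinal kn); have := lem (Ordinal kn).
      by case: e; rewrite !sign_rankE.
    by have [/small //|/ltnW an] := leqP a n; rewrite !(nsigns_size _ _ an) small.
  split=> // a b ab; have [bn|nb] := ltnP b n.+1; last by rewrite !npairs_size // ltnW.
  move: ab bn; rewrite leq_eqVlt => /predU1P[<- an|].
    have := count_add cwf an; have := count_add dwf an.
    have := les true a; have := les false a; lia.
  case: a => [|a] ab bn; first by rewrite !npairs0.
  case: b ab bn => // b ab bn; have an : a < n by lia.
  by have := leo (Ordinal an) (@Ordinal n b bn) ab; rewrite !pair_rankE.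
split=> [i|i|i j ij]; rewrite ?sign_rankE ?pair_rankE //.
by apply: leo; rewrite ltnW.
Qed.

Lemma clan_wf p q (c : clan p q) : wf c.
Proof.
case/and3P: (clan_valP c) => /forallP h1 /forallP h2 _.
by split=> x; apply/eqP.
Qed.

(** * Changing a clan on a few positions *)

Lemma same_off_sum n (A : seq 'I_n) (c d : preclan n)
    (F : 'I_n -> 'I_n -> option bool -> nat) :
  uniq A -> same_off A c d ->
  \sum_s F s (mate d s) (sgn d s) + \sum_(s <- A) F s (mate c s) (sgn c s) =
  \sum_s F s (mate c s) (sgn c s) + \sum_(s <- A) F s (mate d s) (sgn d s).
Proof.
move=> uA off; rewrite !(big_uniq _ uA) /=.
rewrite (bigID (mem A)) [in RHS](bigID (mem A)) /=.
have -> : \sum_(s | s \notin A) F s (mate d s) (sgn d s) =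
          \sum_(s | s \notin A) F s (mate c s) (sgn c s).
  by apply: eq_bigr => s /off[-> ->].
by rewrite addnC addnA addnAC.
Qed.

(** As [A] is closed under the old and the new mates, the two halves glue to an involution; the
    equation on sums keeps the difference of the sign counts. *)
Lemma modify p q (c : clan p q) (A : seq 'I_(p + q))
    (m : 'I_(p + q) -> 'I_(p + q)) (g : 'I_(p + q) -> option bool) :
  uniq A -> {in A, forall x, mate c x \in A} ->
  {in A, forall x, m x \in A /\ m (m x) = x} ->
  {in A, forall x, isSome (g x) = (m x == x)} ->
  \sum_(s <- A) (g s == Some sP) + \sum_(s <- A) (sgn c s == Some sM) =
  \sum_(s <- A) (g s == Some sM) + \sum_(s <- A) (sgn c s == Some sP) ->
  exists d : clan p q,
    same_off A c d /\ {in A, forall x, mate d x = m x /\ sgn d x = g x}.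
Proof.
move=> uA cA mA gA bal.
pose d : preclan (p + q) :=
  ([ffun x => if x \in A then m x else mate c x],
   [ffun x => if x \in A then g x else sgn c x]).
have offd : same_off A c d.
  by move=> x /negPf xA; rewrite /mate /sgn !ffunE xA.
have ond : {in A, forall x, mate d x = m x /\ sgn d x = g x}.
  by move=> x xA; rewrite /mate /sgn !ffunE xA.
have [cK cS] := clan_wf c.
have cNA x : x \notin A -> mate c x \notin A.
  by move=> xA; apply: contra xA => /cA; rewrite cK.
suff dP : is_clan d by exists (Clan dP).
apply/and3P; split.
- apply/forallP => x; apply/eqP; have [xA|xA] := boolP (x \in A).
    by have [h1 h2] := mA x xA; rewrite (ond x xA).1 (ond _ h1).1.
  by rewrite (offd x xA).1 (offd _ (cNA x xA)).1 cK.
- apply/forallP => x; apply/eqP; have [xA|xA] := boolP (x \in A).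
    by case: (ond x xA) => -> ->; exact: gA.
  by case: (offd x xA) => -> ->; exact: cS.
- case/and3P: (clan_valP c) => _ _ /eqP.
  pose cnt (b : preclan (p + q)) e := #|[set i | sgn b i == Some e]|.
  have cntE e : cnt d e + \sum_(s <- A) (sgn c s == Some e) =
                cnt c e + \sum_(s <- A) (g s == Some e).
    have cardE b : cnt b e = \sum_i (sgn b i == Some e).
      rewrite /cnt -sum1_card big_mkcond; apply: eq_bigr => s _.
      by rewrite inE; case: eqP.
    rewrite !cardE (same_off_sum (fun _ _ s => s == Some e) uA offd); congr (_ + _).
    by rewrite !big_seq; apply: eq_bigr => s /ond[_ ->].
  rewrite -/(cnt c true) -/(cnt c false) => balc; apply/eqP.
  rewrite -/(cnt d true) -/(cnt d false); move: bal balc (cntE true) (cntE false).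
  move: (cnt c _) (cnt c _) (cnt d _) (cnt d _) => x1 x2 x3 x4.
  set y1 := bigop _ _ _; set y2 := bigop _ _ _; set y3 := bigop _ _ _.
  set y4 := bigop _ _ _; lia.
Qed.

(** * Effect of the moves *)

Section Moves.
Variables (p q : nat) (c t : clan p q).
Hypothesis ct : rank_le c t.
Local Notation I := 'I_(p + q).

Definition liftable : Prop := exists d : clan p q,
  [/\ bruhat_lt c d, bruhat_le d t & clan_move c d].

Lemma liftableI (d : clan p q) (x : I) : clan_move c d -> mate c x <> mate d x ->
  rank_le c d -> rank_le d t -> liftable.
Proof.
move=> mv neq cd dt; have := clan_wf d; have := clan_wf c; have := clan_wf t.
move=> wt wc wd; exists d; split=> //; last exact/bruhat_leE.
by split; [apply/bruhat_leE | move=> cdE; case: neq; rewrite cdE].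
Qed.


(** The ranks change only by the contributions [old] and [new] of [A]. The first half of each rank
    condition gives [c <= d], the second gives [d <= t]; the changed mate of [x] makes [d] differ
    from [c]. *)
Lemma liftable_modify (A : seq I) (m : I -> I) (g : I -> option bool) x :
  uniq A -> {in A, forall y, mate c y \in A} ->
  {in A, forall y, m y \in A /\ m (m y) = y} ->
  {in A, forall y, isSome (g y) = (m y == y)} ->
  \sum_(s <- A) (g s == Some sP) + \sum_(s <- A) (sgn c s == Some sM) =
  \sum_(s <- A) (g s == Some sM) + \sum_(s <- A) (sgn c s == Some sP) ->
  (forall d : clan p q, same_off A c d ->
     {in A, forall y, mate d y = m y /\ sgn d y = g y} -> clan_move c d) ->
  x \in A -> mate c x <> m x ->
  (forall a b, a <= b ->
     let old := \sum_(s <- A) ((s < a) && (b <= mate c s)) in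
     let new := \sum_(s <- A) ((s < a) && (b <= m s)) in
     old <= new /\ npairs c a b + new <= npairs t a b + old) ->
  (forall e a,
     let old :=
       \sum_(s <- A) ((s < a) && ((sgn c s == Some e) || (mate c s < s))) in
     let new := \sum_(s <- A) ((s < a) && ((g s == Some e) || (m s < s))) in
     new <= old /\ nsigns t e a + old <= nsigns c e a + new) ->
  liftable.
Proof.
move=> uA cA mA gA bal mv xA neq Hop Hsr.
have [d [off on]] := modify uA cA mA gA bal.
have opd a b : npairs d a b + \sum_(s <- A) ((s < a) && (b <= mate c s)) =
               npairs c a b + \sum_(s <- A) ((s < a) && (b <= m s)).
  rewrite /npairs (same_off_sum (fun s m _ => (s < a) && (b <= m)) uA off).
  by congr (_ + _); rewrite !big_seq; apply: eq_bigr => s /on[-> _].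
have srd e a : nsigns d e a +
    \sum_(s <- A) ((s < a) && ((sgn c s == Some e) || (mate c s < s))) =
    nsigns c e a + \sum_(s <- A) ((s < a) && ((g s == Some e) || (m s < s))).
  pose F (s m : I) (g : option bool) : nat := (s < a) && ((g == Some e) || (m < s)).
  rewrite /nsigns (same_off_sum F uA off).
  by congr (_ + _); rewrite !big_seq; apply: eq_bigr => s /on[-> ->].
have dE : mate d x = m x by case: (on x xA).
apply: (liftableI (mv d off on) (x := x)); first by rewrite dE.
- have le_new (x1 x2 o w : nat) : o <= w -> x2 + o = x1 + w -> x1 <= x2.
    by lia.
  split=> [a b ab|e a]; first by apply: le_new (opd a b); case: (Hop a b ab).
  by apply: le_new (esym (srd e a)); case: (Hsr e a).
- have le_slack (x1 x2 y o w : nat) : x1 + w <= y + o -> x2 + o = x1 + w -> x2 <= y.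
    by lia.
  have ge_slack (x1 x2 y o w : nat) : y + o <= x1 + w -> x2 + o = x1 + w -> y <= x2.
    by lia.
  split=> [a b ab|e a]; first by apply: le_slack (opd a b); case: (Hop a b ab).
  by apply: ge_slack (srd e a); case: (Hsr e a).
Qed.

Lemma mate_sgn (x : I) e : sgn c x = Some e -> mate c x = x.
Proof. by have [_ cS] := clan_wf c; move=> cx; apply/eqP; rewrite -cS cx. Qed.

Lemma mate_sym (x y : I) : mate c x = y -> mate c y = x.
Proof. by have [cK _] := clan_wf c; move=> <-. Qed.

Lemma sgn_mate (x y : I) : x < y -> mate c x = y -> sgn c x = None /\ sgn c y = None.
Proof.
move=> xy cx; have cy := mate_sym cx; have [_ cS] := clan_wf c.
have := cS x; have := cS y; rewrite cx cy -!val_eqE /= (gtn_eqF xy) (ltn_eqF xy).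
by case: (sgn c x); case: (sgn c y).
Qed.

Lemma ltn_neq (x y : I) : x < y -> ((x == y) = false) * ((y == x) = false).
Proof. by move=> xy; rewrite -!val_eqE /= ltn_eqF // gtn_eqF. Qed.

(** The move raises [npairs] by one for [i < a <= b <= k] and lowers [nsigns e] by one for
    [i < a <= k], so strictness is required exactly there. The lemmas for the other moves are built
    in the same way. *)
Lemma lift_signs (i k : I) e : i < k ->
  sgn c i = Some e -> sgn c k = Some (~~ e) ->
  (forall a b, i < a -> a <= b -> b <= k -> npairs c a b < npairs t a b) ->
  (forall a, i < a -> a <= k -> nsigns t e a < nsigns c e a) -> liftable.
Proof.
move=> ik ci ck Hop Hsr.
have mi := mate_sgn ci; have mk := mate_sgn ck; have Nik := ltn_neq ik.
apply: (@liftable_modify [:: i; k] (fun x => if x == i then k else i)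
  (fun=> None) i); rewrite ?big_cons ?big_nil ?mi ?mk ?ci ?ck ?inE ?eqxx //.
- by rewrite /= inE Nik.
- by move=> x; rewrite !inE => /orP[]/eqP->; rewrite ?mi ?mk eqxx ?orbT.
- by move=> x; rewrite !inE => /orP[]/eqP->; rewrite ?(eqxx, Nik, orbT).
- by move=> x; rewrite !inE => /orP[]/eqP->; rewrite ?(eqxx, Nik, orbT).
- by case: (e).
- move=> d off on; have := on i; have := on k.
  rewrite !inE !(eqxx, Nik, orbT) => /(_ isT)[dk sk] /(_ isT)[di si].
  have dik : matched d i k by split=> // E; rewrite E ltnn in ik.
  by case: e ci ck {Hsr} => ci ck;
    [apply: (@Move_pm_11 _ c d i k) | apply: (@Move_mp_11 _ c d i k)].
- by move=> E; rewrite E ltnn in ik.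
- move=> a b ab /=; rewrite !big_cons !big_nil !(eqxx, Nik, mi, mk).
  by have := Hop a b; have := ct.1 a b ab; lia.
- move=> f a /=; rewrite !big_cons !big_nil !(eqxx, Nik, mi, mk, ci, ck).
  have := ct.2 f a; have := Hsr a.
  by case: e {ci ck Hsr}; case: f => /=; lia.
Qed.

Lemma lift_sign_pair (i j k : I) e : i < j -> j < k ->
  sgn c i = Some e -> mate c j = k ->
  (forall a b, i < a -> a <= j -> a <= b -> b <= k -> npairs c a b < npairs t a b) ->
  (forall a, i < a -> a <= j -> nsigns t e a < nsigns c e a) -> liftable.
Proof.
move=> ij jk ci mj Hop Hsr; have ik := ltn_trans ij jk.
have mi := mate_sgn ci; have mk := mate_sym mj; have [cj ck] := sgn_mate jk mj.
have N := (ltn_neq ij, ltn_neq jk, ltn_neq ik).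
have E := (eqxx, N, orbT, mi, mj, mk, ci, cj, ck).
apply: (@liftable_modify [:: i; j; k]
  (fun x => if x == i then k else if x == j then j else i)
  (fun x => if x == j then Some e else None) i); rewrite ?(big_cons, big_nil, E) ?inE ?E //.
- by rewrite /= !inE !E.
- by move=> x; rewrite !inE => /or3P[]/eqP->; rewrite ?E.
- by move=> x; rewrite !inE => /or3P[]/eqP->; rewrite ?E.
- by move=> x; rewrite !inE => /or3P[]/eqP->; rewrite ?E.
- by case: (e).
- move=> d off on; have := on i; have := on j; have := on k.
  rewrite !inE !E => /(_ isT)[dk sk] /(_ isT)[dj sj] /(_ isT)[di si].
  have dik : matched d i k by split=> // Eq; rewrite Eq ltnn in ik.
  have cjk : matched c j k by split=> // Eq; rewrite Eq ltnn in jk.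
  by case: e ci sj {Hsr E on} => ci sj;
    [apply: (@Move_p11_1p1 _ c d i j k) | apply: (@Move_m11_1m1 _ c d i j k)].
- by move=> Eq; rewrite Eq ltnn in ik.
- move=> a b ab /=; rewrite !big_cons !big_nil !E.
  by have := Hop a b; have := ct.1 a b ab; lia.
- move=> f a /=; rewrite !big_cons !big_nil !E.
  have := ct.2 f a; have := Hsr a.
  by case: e {ci Hsr E}; case: f => /=; lia.
Qed.

Lemma lift_pair_sign (i j k : I) e : i < j -> j < k ->
  mate c i = j -> sgn c k = Some e ->
  (forall a b, i < a -> a <= b -> j < b -> b <= k -> npairs c a b < npairs t a b) ->
  (forall a, j < a -> a <= k -> nsigns t (~~ e) a < nsigns c (~~ e) a) -> liftable.
Proof.
move=> ij jk mi ck Hop Hsr; have ik := ltn_trans ij jk.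
have mk := mate_sgn ck; have mj := mate_sym mi; have [ci cj] := sgn_mate ij mi.
have N := (ltn_neq ij, ltn_neq jk, ltn_neq ik).
have E := (eqxx, N, orbT, mi, mj, mk, ci, cj, ck).
apply: (@liftable_modify [:: i; j; k]
  (fun x => if x == i then k else if x == j then j else i)
  (fun x => if x == j then Some e else None) i); rewrite ?(big_cons, big_nil, E) ?inE ?E //.
- by rewrite /= !inE !E.
- by move=> x; rewrite !inE => /or3P[]/eqP->; rewrite ?E.
- by move=> x; rewrite !inE => /or3P[]/eqP->; rewrite ?E.
- by move=> x; rewrite !inE => /or3P[]/eqP->; rewrite ?E.
- by case: (e).
- move=> d off on; have := on i; have := on j; have := on k.
  rewrite !inE !E => /(_ isT)[dk sk] /(_ isT)[dj sj] /(_ isT)[di si].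
  have dik : matched d i k by split=> // Eq; rewrite Eq ltnn in ik.
  have cij : matched c i j by split=> // Eq; rewrite Eq ltnn in ij.
  by case: e ck sj {Hsr E on} => ck sj;
    [apply: (@Move_11p_1p1 _ c d i j k) | apply: (@Move_11m_1m1 _ c d i j k)].
- by move=> Eq; rewrite Eq ltnn in jk.
- move=> a b ab /=; rewrite !big_cons !big_nil !E.
  by have := Hop a b; have := ct.1 a b ab; lia.
- move=> f a /=; rewrite !big_cons !big_nil !E.
  have := ct.2 f a; have := Hsr a.
  by case: e {ck Hsr E}; case: f => /=; lia.
Qed.

Lemma lift_pairs_nest (i j k l : I) e : i < j -> j < k -> k < l ->
  mate c i = j -> mate c k = l ->
  (forall a b, i < a -> a <= k -> a <= b -> j < b -> b <= l ->
     npairs c a b < npairs t a b) ->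
  (forall a, j < a -> a <= k -> nsigns t (~~ e) a < nsigns c (~~ e) a) -> liftable.
Proof.
move=> ij jk kl mi mk Hop Hsr; have ik := ltn_trans ij jk.
have jl := ltn_trans jk kl; have il := ltn_trans ij jl.
have mj := mate_sym mi; have [ci cj] := sgn_mate ij mi.
have ml := mate_sym mk; have [ck cl] := sgn_mate kl mk.
have N := (ltn_neq ij, ltn_neq jk, ltn_neq ik, ltn_neq il, ltn_neq jl, ltn_neq kl).
have E := (eqxx, N, orbT, (mi, mj, mk, ml), (ci, cj, ck, cl)).
apply: (@liftable_modify [:: i; j; k; l]
  (fun x => if x == i then l else if x == l then i else x)
  (fun x => if x == j then Some e else if x == k then Some (~~ e) else None) i);
  rewrite ?(big_cons, big_nil, E) ?inE ?E //.
- by rewrite /= !inE !E.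
- by move=> x; rewrite !inE => /or4P[]/eqP->; rewrite ?E.
- by move=> x; rewrite !inE => /or4P[]/eqP->; rewrite ?E.
- by move=> x; rewrite !inE => /or4P[]/eqP->; rewrite ?E.
- by case: (e).
- move=> d off on; have := on i; have := on j; have := on k.
  rewrite !inE !E => /(_ isT)[dk sk] /(_ isT)[dj sj] /(_ isT)[di si].
  have dil : matched d i l by split=> // Eq; rewrite Eq ltnn in il.
  have cij : matched c i j by split=> // Eq; rewrite Eq ltnn in ij.
  have ckl : matched c k l by split=> // Eq; rewrite Eq ltnn in kl.
  by case: e sk sj {Hsr E on} => sk sj;
    [apply: (@Move_1122_1pm1 _ c d i j k l) | apply: (@Move_1122_1mp1 _ c d i j k l)].
- by move=> Eq; rewrite Eq ltnn in jl.
- move=> a b ab /=; rewrite !big_cons !big_nil !E.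
  by have := Hop a b; have := ct.1 a b ab; lia.
- move=> f a /=; rewrite !big_cons !big_nil !E.
  have := ct.2 f a; have := Hsr a.
  by case: e {Hsr E}; case: f => /=; lia.
Qed.

(** Moving the ends [j] and [k] raises [npairs] on two regions, [i < a], [j < b <= k] and
    [j < a <= k], [b <= l]. On their overlap the increase is two, whence the stronger second
    hypothesis. *)
Lemma lift_pairs_cross (i j k l : I) : i < j -> j < k -> k < l ->
  mate c i = j -> mate c k = l ->
  (forall a b, i < a -> a <= j -> j < b -> b <= k -> npairs c a b < npairs t a b) ->
  (forall a b, j < a -> a <= b -> b <= k -> (npairs c a b).+1 < npairs t a b) ->
  (forall a b, j < a -> a <= k -> k < b -> b <= l -> npairs c a b < npairs t a b) ->
  (forall f a, j < a -> a <= k -> nsigns t f a < nsigns c f a) -> liftable.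
Proof.
move=> ij jk kl mi mk Hop1 Hop2 Hop3 Hsr; have ik := ltn_trans ij jk.
have jl := ltn_trans jk kl; have il := ltn_trans ij jl.
have mj := mate_sym mi; have [ci cj] := sgn_mate ij mi.
have ml := mate_sym mk; have [ck cl] := sgn_mate kl mk.
have N := (ltn_neq ij, ltn_neq jk, ltn_neq ik, ltn_neq il, ltn_neq jl, ltn_neq kl).
have E := (eqxx, N, orbT, (mi, mj, mk, ml), (ci, cj, ck, cl)).
apply: (@liftable_modify [:: i; j; k; l]
  (fun x => if x == i then k else if x == k then i else if x == j then l else j)
  (fun x => None) i); rewrite ?(big_cons, big_nil, E) ?inE ?E //.
- by rewrite /= !inE !E.
- by move=> x; rewrite !inE => /or4P[]/eqP->; rewrite ?E.
- by move=> x; rewrite !inE => /or4P[]/eqP->; rewrite ?E.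
- by move=> x; rewrite !inE => /or4P[]/eqP->; rewrite ?E.
- move=> d off on; have := on i; have := on j.
  rewrite !inE !E => /(_ isT)[dj sj] /(_ isT)[di si].
  apply: (@Move_1122_1212 _ c d i j k l) => //; split=> // Eq;
  by rewrite Eq ltnn in ij ik jl kl.
- by move=> Eq; rewrite Eq ltnn in jk.
- move=> a b ab /=; rewrite !big_cons !big_nil !E.
  move: (Hop1 a b) (Hop2 a b) (Hop3 a b) (ct.1 a b ab) => {Hop1 Hop2 Hop3 Hsr E N}.
  case: (leqP a i) => h1; case: (leqP a j) => h2; case: (leqP a k) => h3;
    try (exfalso; clear -ij jk kl h1 h2 h3; lia);
  case: (leqP b j) => h4; case: (leqP b k) => h5; case: (leqP b l) => h6;
    try (exfalso; clear -ij jk kl ab h1 h2 h3 h4 h5 h6; lia);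
  rewrite /= ?ab ?andbT ?andbF; lia.
- move=> f a /=; rewrite !big_cons !big_nil !E /=.
  have := ct.2 f a; have := Hsr f a; lia.
Qed.

Lemma lift_cross_nest (i j k l : I) : i < j -> j < k -> k < l ->
  mate c i = k -> mate c j = l ->
  (forall a b, i < a -> a <= j -> k < b -> b <= l -> npairs c a b < npairs t a b) ->
  liftable.
Proof.
move=> ij jk kl mi mj Hop; have ik := ltn_trans ij jk.
have jl := ltn_trans jk kl; have il := ltn_trans ij jl.
have mk := mate_sym mi; have [ci ck] := sgn_mate ik mi.
have ml := mate_sym mj; have [cj cl] := sgn_mate jl mj.
have N := (ltn_neq ij, ltn_neq jk, ltn_neq ik, ltn_neq il, ltn_neq jl, ltn_neq kl).
have E := (eqxx, N, orbT, (mi, mj, mk, ml), (ci, cj, ck, cl)).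
apply: (@liftable_modify [:: i; j; k; l]
  (fun x => if x == i then l else if x == l then i else if x == j then k else j)
  (fun x => None) i); rewrite ?(big_cons, big_nil, E) ?inE ?E //.
- by rewrite /= !inE !E.
- by move=> x; rewrite !inE => /or4P[]/eqP->; rewrite ?E.
- by move=> x; rewrite !inE => /or4P[]/eqP->; rewrite ?E.
- by move=> x; rewrite !inE => /or4P[]/eqP->; rewrite ?E.
- move=> d off on; have := on i; have := on j.
  rewrite !inE !E => /(_ isT)[dj sj] /(_ isT)[di si].
  apply: (@Move_1212_1221 _ c d i j k l) => //; split=> // Eq;
  by rewrite Eq ltnn in ik jl il jk.
- by move=> Eq; rewrite Eq ltnn in kl.
- move=> a b ab /=; rewrite !big_cons !big_nil !E.
  have := Hop a b; have := ct.1 a b ab; lia.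
- move=> f a /=; rewrite !big_cons !big_nil !E /=.
  have := ct.2 f a; lia.
Qed.

End Moves.

(** * The first difference *)

(* Given agreement at all earlier positions, this says that the character types
   coincide and that a closing position closes the same pair. *)
Definition agree n (c t : preclan n) (x : 'I_n) : bool :=
  (sgn c x == sgn t x) &&
  ((mate c x < x) || (mate t x < x) ==> (mate c x == mate t x)).

Lemma agreeC n (c t : preclan n) x : agree c t x = agree t c x.
Proof. by rewrite /agree eq_sym orbC [mate c x == _]eq_sym. Qed.

Lemma agree_ltn n (c t : preclan n) x :
  agree c t x -> (mate c x < x) = (mate t x < x).
Proof.
case/andP=> _; case h1: (mate c x < x); case h2: (mate t x < x) => //= /eqP E;
  by rewrite E h2 in h1.
Qed.

Lemma agree_mate n (c t : preclan n) (s : 'I_n) m : wf c -> wf t -> s < m ->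
  (forall x : 'I_n, x < m -> agree c t x) -> mate c s < m ->
  mate t s = mate c s.
Proof.
move=> cwf twf sm ag cm; have /andP[/eqP sE mE] := ag s sm.
case: (sgnP cwf s) => [[e [ce cs]]|[_ cs]|[_ cs]].
- have [_ tS] := twf; apply/eqP; rewrite cs -tS -sE ce //.
- have /andP[_] := ag _ cm; rewrite (wfK cwf) cs /= => /eqP {1}->.
  by rewrite (wfK twf).
- by move: mE; rewrite cs => /eqP.
Qed.

Lemma agree_npairs n (c t : preclan n) a m : wf c -> wf t -> a <= m ->
  (forall x : 'I_n, x < m -> agree c t x) -> npairs c a m = npairs t a m.
Proof.
move=> cwf twf am ag; apply: eq_bigr => s _; case sa: (s < a) => //=.
have sm := leq_trans sa am.
have ga (x : 'I_n) : x < m -> agree t c x by move=> /ag; rewrite agreeC.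
suff lt_eq : (mate c s < m) = (mate t s < m) by rewrite leqNgt lt_eq -leqNgt.
apply/idP/idP => h; last by rewrite (agree_mate twf cwf sm ga h).
by rewrite (agree_mate cwf twf sm ag h).
Qed.

Lemma agree_nsigns n (c t : preclan n) e m :
  (forall x : 'I_n, x < m -> agree c t x) -> nsigns c e m = nsigns t e m.
Proof.
move=> ag; apply: eq_bigr => s _; case sm: (s < m) => //=.
by rewrite (agree_ltn (ag s sm)); case/andP: (ag s sm) => /eqP->.
Qed.

Lemma agree_eq p q (c t : clan p q) : (forall x, agree c t x) -> c = t.
Proof.
move=> ag; apply: val_inj; apply/pair_eqP/andP; split; apply/eqP/ffunP=> x.
  apply/esym/(@agree_mate _ c t x (p + q)); rewrite ?ltn_ord //; exact: clan_wf.
by case/andP: (ag x) => /eqP.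
Qed.

Lemma first_ord n (P : pred 'I_n) x0 : P x0 ->
  exists x, P x /\ forall y : 'I_n, y < x -> ~~ P y.
Proof.
move=> Px0; case: (arg_minnP (fun x : 'I_n => val x) Px0) => x Px xmin.
by exists x; split=> // y yx; apply/negP => /xmin; rewrite leqNgt yx.
Qed.

Lemma least_from M N (P : pred nat) : M <= N -> P N ->
  exists b, [/\ M <= b, b <= N, P b & forall x, M <= x -> x < b -> ~~ P x].
Proof.
move=> MN PN; have ex : exists b, (M <= b) && P b by exists N; rewrite MN.
case: (ex_minnP ex) => b /andP[Mb Pb] bmin; exists b; split=> //.
  by apply: bmin; rewrite MN.
by move=> x Mx xb; apply/negP=> Px; have := bmin x; rewrite Mx Px leqNgt xb => /(_ isT).
Qed.

(** * Propagating slack from a tight level *)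

Section Slack.
Variables (p q : nat) (c t : clan p q).
Hypothesis ct : rank_le c t.
Local Notation I := 'I_(p + q).
Let cwf := clan_wf c.
Let twf := clan_wf t.

(* Tightness at [(M, Y)] turns into an upper bound for the pairs [c] opens in
   [[M, a)], all of which close at [Y] or later. *)
Lemma npairs_slack M a b Y : M <= a -> a <= p + q -> a <= b -> b <= Y ->
  npairs t M Y <= npairs c M Y ->
  (forall x : I, M <= x < a -> x < mate c x -> Y <= mate c x) ->
  npairs c a b + npairs t M b <= npairs t a b + npairs c M b.
Proof.
move=> Ma an ab bY tc H; have := npairs_ge_mono t Ma bY an.
have := @npairs_le_mono _ c M a b Y Ma bY _ an.
have := ct.1 a Y; rewrite (leq_trans ab bY) => /(_ isT) h1 h2 h3.
have {}h2 : npairs c a b + npairs c M Y <= npairs c M b + npairs c a Y.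
  by apply: h2 => x xa bx; apply: H => //; case/andP: xa => _ xa; lia.
lia.
Qed.

(** On [[M, a)] the sum of [nsigns f] and [npairs] at level [Y] grows at least as fast for [c] as
    for [t]; tightness at [(M, Y)] and the order at [(a, Y)] cancel the [npairs] terms. *)
Lemma nsigns_slack f M a Y : M <= a -> a <= p + q -> a <= Y ->
  npairs t M Y <= npairs c M Y ->
  (forall x : I, M <= x < a -> sgn c x != Some (~~ f)) ->
  (forall x : I, M <= x < a -> x < mate c x -> Y <= mate c x) ->
  nsigns t f a + nsigns c f M <= nsigns c f a + nsigns t f M.
Proof.
move=> Ma an aY tc H1 H2; have := count_growth_ge cwf Ma an H1 H2.
by have := count_growth_le twf f Ma an aY; have := ct.1 a Y aY; lia.
Qed.

(** This bounds the slack at [(M, z)] from below. It yields the contradiction when no suitable [k]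
    exists. *)
Lemma slack_drop f M z : M <= z -> z <= p + q ->
  (forall x : I, M <= x < z -> sgn c x != Some f) ->
  (forall x : I, M <= x < z -> x < mate c x -> z <= mate c x) ->
  nsigns t f M + npairs t M M + npairs c M z <= nsigns c f M + npairs c M M + npairs t M z.
Proof.
move=> Mz zn H1 H2; have := nsigns_closing_le cwf Mz zn H1 H2.
by have := nsigns_closing_ge twf f Mz zn; have := ct.2 f z; lia.
Qed.

End Slack.

(** * Case analysis at the first differing position *)

Section FirstDifference.
Variables (p q : nat) (c t : clan p q).
Hypothesis ct : rank_le c t.
Local Notation I := 'I_(p + q).
Let cwf := clan_wf c.
Let twf := clan_wf t.
Variable m : I.
Hypothesis agm : forall x : I, x < m -> agree c t x.

Let Gm a : a <= m -> npairs c a m = npairs t a m.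
Proof. by move=> am; apply: agree_npairs. Qed.

Let Sm e : nsigns c e m = nsigns t e m.
Proof. exact: agree_nsigns. Qed.

Lemma lift_sign_open e : sgn c m = Some e -> m < mate t m -> liftable c t.
Proof.
move=> cm tm; have mm := mate_sgn cm.
have [tmN _] := sgn_mate tm erefl.
have cMM : npairs c m.+1 m.+1 = npairs c m m.
  by have := npairs_mate cwf m m; have := npairsS c m m.+1; rewrite mm; lia.
have tMM : npairs t m.+1 m.+1 = (npairs t m m).+1.
  by have := npairs_mate twf m m; have := npairsS t m m.+1; lia.
have GE := Gm (leqnn m).
have srt f : nsigns t f m.+1 = nsigns t f m by rewrite nsignsS tmN ltnNge (ltnW tm) addn0.
have src f : nsigns c f m.+1 = nsigns c f m + (f == e).
  by rewrite nsignsS cm mm ltnn orbF; case: (e); case: (f).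
(* [Y] is the first level where the slack at [m.+1] is exhausted; at [p + q] both counts vanish. *)
have [Y [MY Yn tcY Ymin]] : exists Y, [/\ m < Y, Y <= p + q,
    npairs t m.+1 Y <= npairs c m.+1 Y &
    forall b, m < b -> b < Y -> ~~ (npairs t m.+1 b <= npairs c m.+1 b)].
  apply: (@least_from m.+1 (p + q) (fun b => npairs t m.+1 b <= npairs c m.+1 b)) => //.
  by rewrite !npairs_size.
pose P (k : I) := (m < k < Y) &&
  ((sgn c k == Some (~~ e)) || (k < mate c k) && (mate c k < Y)).
have [k0 Pk0|P0] := pickP P; last first.
  (* The counts for [~~ e] agree at [m.+1] and the diagonal slack is one, so slack would survive at
     [Y]. *)
  have := @slack_drop _ _ c t ct (~~ e) m.+1 Y MY Yn.
  have h1 (x : I) : m < x < Y -> sgn c x != Some (~~ e).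
    by move=> xY; have := P0 x; rewrite /P xY /= => /negbT/norP[].
  have h2 (x : I) : m < x < Y -> x < mate c x -> Y <= mate c x.
    move=> xY xm; have := P0 x; rewrite /P xY xm /= => /negbT/norP[_].
    by rewrite -leqNgt.
  rewrite srt src Sm; have -> : (~~ e == e) = false by case: (e).
  by move=> /(_ h1 h2); lia.
have [k [/andP[/andP[mk kY] Pk] kmin]] := first_ord Pk0.
have kn := ltn_ord k.
have h1 a : a <= k -> forall x : I, m < x < a -> sgn c x != Some (~~ e).
  move=> ak x /andP[mx xa]; have := kmin x (leq_trans xa ak).
  by rewrite /P mx (ltn_trans (leq_trans xa ak) kY) /= => /norP[].
have h2 a : a <= k -> forall x : I, m < x < a -> x < mate c x -> Y <= mate c x.
  move=> ak x /andP[mx xa] xm; have := kmin x (leq_trans xa ak).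
  by rewrite /P mx (ltn_trans (leq_trans xa ak) kY) /= => /norP[_]; rewrite xm -leqNgt.
have Hop a b : m < a -> a <= k -> a <= b -> b < Y -> npairs c a b < npairs t a b.
  move=> ma ak ab bY; have an : a <= p + q by lia.
  have := npairs_slack ct ma an ab (ltnW bY) tcY (h2 a ak).
  by have := Ymin b (leq_trans ma ab) bY; lia.
have Hsr a : m < a -> a <= k -> nsigns t e a < nsigns c e a.
  move=> ma ak; have an : a <= p + q by lia.
  have aY : a <= Y by lia.
  have := nsigns_slack ct ma an aY tcY (h1 a ak) (h2 a ak).
  by rewrite srt src Sm eqxx; lia.
case/orP: Pk => [/eqP ck|/andP[kk kmY]].
- by apply: (lift_signs ct mk cm ck) => // a b ma ab bk; apply: Hop => //; lia.
- apply: (lift_sign_pair ct mk kk cm erefl) => // a b ma ak ab bk.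
  by apply: Hop => //; lia.
Qed.

(** * The case where [c] closes a pair at [m] *)

Section Closing.
Let i := mate c m.
Hypothesis im : i < m.

Let mi : mate c i = m.
Proof. exact: wfK. Qed.

Lemma closing_npairs a : npairs c a m = npairs c a m.+1 + (i < a).
Proof. exact: npairs_mate. Qed.

Lemma closing_npairsS b : m < b -> npairs c m.+1 b = npairs c m b.
Proof. by move=> mb; rewrite npairsS -/i; lia. Qed.

Lemma first_tight_level u : i < u -> exists J, [/\ m < J, J <= p + q,
  exists a, [/\ i < a, a <= u & npairs t a J <= npairs c a J] &
  forall a b, i < a -> a <= u -> m < b -> b < J -> npairs c a b < npairs t a b].
Proof.
move=> iu; pose P b := has (fun a => npairs t a b <= npairs c a b) (iota i.+1 (u - i)).
have uE : i.+1 + (u - i) = u.+1 by lia.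
have mn := ltn_ord m.
have [||J [mJ Jn /hasP[a ai tc] Jmin]] := @least_from m.+1 (p + q) P => //.
  apply/hasP; exists u; first by rewrite mem_iota uE; lia.
  by rewrite !npairs_size.
exists J; split=> //.
  by exists a; move: ai; rewrite mem_iota uE => /andP[-> ].
move=> a' b ia au mb bJ; rewrite ltnNge; apply/negP => tcb.
have /hasP[] := Jmin b mb bJ; exists a' => //.
by rewrite mem_iota uE; lia.
Qed.

Lemma crossing_or u J :
  (forall a b, i < a -> a <= u -> m < b -> b < J -> npairs c a b < npairs t a b) ->
  liftable c t \/
  forall s : I, i < s -> s <= u -> s < m -> m < mate c s -> J <= mate c s.
Proof.
move=> slack; pose P (s : I) := [&& i < s, s <= u, s < m, m < mate c s & mate c s < J].
have [s /and5P[is_ su sm ms sJ]|P0] := pickP P; [left | right].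
  apply: (lift_cross_nest ct is_ sm ms mi erefl) => a b ia as_ mb bs.
  by apply: slack => //; lia.
move=> s is_ su sm ms; have := P0 s; rewrite /P is_ su sm ms /= => /negbT.
by rewrite -leqNgt.
Qed.

Lemma lift_closings : mate t m < m -> mate t m != i -> liftable c t.
Proof.
set i' := mate t m => tm ne.
have topM a : npairs t a m = npairs t a m.+1 + (i' < a) by exact: npairs_mate.
(* If [i' < i], the pair closed by [t] alone would break the order at [(i, m.+1)]. *)
have ii : i < i'.
  rewrite ltnNge; apply/negP; rewrite leq_eqVlt => /predU1P[/val_inj E|ii].
    by rewrite E eqxx in ne.
  have := Gm (ltnW im); have := closing_npairs i; have := topM i.
  by have := ct.1 i m.+1 (leqW (ltnW im)); lia.
have [J [mJ Jn [a0 [ia0 a0i tc]] slack]] := first_tight_level ii.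
have [//|out] := crossing_or slack.
(* Without a crossing pair, tightness at [(a0, J)] carried to [i'.+1] breaks the order at
   [(i'.+1, J)]: at level [m.+1] the slack is one at [a0] but zero at [i'.+1]. *)
have a0n : a0 <= i'.+1 by lia.
have h := @npairs_le_mono _ c a0 i'.+1 m.+1 J a0n mJ _ (ltn_ord i').
have {}h : npairs c i'.+1 m.+1 + npairs c a0 J <= npairs c a0 m.+1 + npairs c i'.+1 J.
  by apply: h => x /andP[ax xi] mx; apply: out => //; lia.
have := npairs_ge_mono t a0n mJ (ltn_ord i').
have := Gm (leq_trans a0i (ltnW tm)); have := closing_npairs a0; have := topM a0.
have := Gm tm; have := closing_npairs i'.+1; have := topM i'.+1.
by have := ct.1 i'.+1 J (leq_trans tm (ltnW mJ)); lia.
Qed.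

Hypothesis tm : m <= mate t m.

Let topM a : a <= m -> npairs t a m = npairs t a m.+1.
Proof. by move=> am; have := npairs_mate twf a m; lia. Qed.

(* If a pair of [c] opened in [(i, m)] closes in [(m, J)], the move 1212 -> 1221
   applied to it and [(i, m)] stays below [t]; otherwise tightness at some [(a0, J)] moves up
   to [(m, J)]. *)
Lemma lift_or_tight_level : liftable c t \/ exists J, [/\ m < J, J <= p + q,
  npairs t m J <= npairs c m J &
  forall a b, i < a -> a <= m -> m < b -> b < J -> npairs c a b < npairs t a b].
Proof.
have [J [mJ Jn [a0 [ia0 a0m tc]] slack]] := first_tight_level im.
have [|out] := crossing_or slack; [by left | right].
exists J; split=> //; have mn := ltnW (ltn_ord m).
have h := @npairs_le_mono _ c a0 m m.+1 J a0m mJ _ mn.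
have {}h : npairs c m m.+1 + npairs c a0 J <= npairs c a0 m.+1 + npairs c m J.
  by apply: h => x /andP[ax xi] mx; apply: out => //; lia.
have := npairs_ge_mono t a0m mJ mn.
have := Gm a0m; have := closing_npairs a0; have := topM a0m.
by have := Gm (leqnn m); have := closing_npairs m; have := topM (leqnn m); lia.
Qed.

Lemma lift_closing_sign e : sgn t m = Some e -> liftable c t.
Proof.
move=> te; have tmm := mate_sgn te; have [|[J [mJ Jn tcJ slack]]] := lift_or_tight_level => //.
have [_ cm] := sgn_mate im mi.
have topb b : m < b -> npairs t m.+1 b = npairs t m b by move=> mb; rewrite npairsS tmm; lia.
(* Neither clan opens a pair at [m], so tightness passes from [m] to [m.+1] and [J] serves as
   [Y]. *)
have tcY : npairs t m.+1 J <= npairs c m.+1 J by rewrite topb // closing_npairsS.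
have MM : npairs t m.+1 m.+1 = (npairs c m.+1 m.+1).+1.
  rewrite topb // closing_npairsS //; have := Gm (leqnn m); have := closing_npairs m.
  by have := topM (leqnn m); lia.
have src f : nsigns c f m.+1 = (nsigns t f m).+1 by rewrite nsignsS -/i im orbT Sm addn1.
have srt f : nsigns t f m.+1 = nsigns t f m + (f == e).
  by rewrite nsignsS te tmm ltnn orbF; case: (e); case: (f).
pose P (k : I) := (m < k < J) &&
  ((sgn c k == Some e) || (k < mate c k) && (mate c k < J)).
have [k0 Pk0|P0] := pickP P; last first.
  have := @slack_drop _ _ c t ct e m.+1 J mJ Jn.
  have h1 (x : I) : m < x < J -> sgn c x != Some e.
    by move=> xY; have := P0 x; rewrite /P xY /= => /negbT/norP[].
  have h2 (x : I) : m < x < J -> x < mate c x -> J <= mate c x.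
    move=> xY xm; have := P0 x; rewrite /P xY xm /= => /negbT/norP[_].
    by rewrite -leqNgt.
  rewrite srt src eqxx.
  by move=> /(_ h1 h2); lia.
have [k [/andP[/andP[mk kJ] Pk] kmin]] := first_ord Pk0.
have kn := ltn_ord k.
have h1 a : a <= k -> forall x : I, m < x < a -> sgn c x != Some (~~ (~~ e)).
  move=> ak x /andP[mx xa]; have := kmin x (leq_trans xa ak); rewrite negbK.
  by rewrite /P mx (ltn_trans (leq_trans xa ak) kJ) /= => /norP[].
have h2 a : a <= k -> forall x : I, m < x < a -> x < mate c x -> J <= mate c x.
  move=> ak x /andP[mx xa] xm; have := kmin x (leq_trans xa ak).
  by rewrite /P mx (ltn_trans (leq_trans xa ak) kJ) /= => /norP[_]; rewrite xm -leqNgt.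
have Hop a b : i < a -> a <= k -> a <= b -> m < b -> b < J -> npairs c a b < npairs t a b.
  move=> ia ak ab mb bJ; have [am|ma] := leqP a m; first exact: slack.
  have an : a <= p + q by lia.
  have := npairs_slack ct ma an ab (ltnW bJ) tcY (h2 a ak).
  have := slack m b im (leqnn m) mb bJ.
  by rewrite -topb // -closing_npairsS //; lia.
have Hsr a : m < a -> a <= k -> nsigns t (~~ e) a < nsigns c (~~ e) a.
  move=> ma ak; have an : a <= p + q by lia.
  have aY : a <= J by lia.
  have := nsigns_slack ct ma an aY tcY (h1 a ak) (h2 a ak).
  by rewrite srt src; case: (e); rewrite /=; lia.
case/orP: Pk => [/eqP ck|/andP[kk kmJ]].
- by apply: (lift_pair_sign ct im mk mi ck) => // a b ma ab mb bk; apply: Hop => //; lia.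
- apply: (@lift_pairs_nest _ _ c t ct i m k (mate c k) e) => // a b ia ak ab mb bk.
  by apply: Hop => //; lia.
Qed.

(* Replacing 1122 by 1212 needs slack two on part of its range, hence the extra
   level [Z], before which the slack at [m.+1] is at least two; it satisfies
   [Z <= J] and [Z <= Y]. *)
Lemma lift_closing_open : m < mate t m -> liftable c t.
Proof.
move=> mt; have [|[J [mJ Jn tcJ slack]]] := lift_or_tight_level => //.
have [tmN _] := sgn_mate mt erefl.
have topb b : npairs t m.+1 b = npairs t m b + (b <= mate t m) by rewrite npairsS.
have MM : npairs t m.+1 m.+1 = (npairs c m.+1 m.+1).+2.
  rewrite topb closing_npairsS //; have := Gm (leqnn m); have := closing_npairs m.
  by have := topM (leqnn m); lia.
have src f : nsigns c f m.+1 = (nsigns t f m).+1 by rewrite nsignsS -/i im orbT Sm addn1.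
have srt f : nsigns t f m.+1 = nsigns t f m by rewrite nsignsS tmN ltnNge (ltnW mt) addn0.
have mn := ltn_ord m.
have [||Y [mY Yn tcY Ymin]] := @least_from m.+1 (p + q)
  (fun b => npairs t m.+1 b <= npairs c m.+1 b) => //; first by rewrite !npairs_size.
have tcJ1 : npairs t m.+1 J <= (npairs c m.+1 J).+1.
  by rewrite topb closing_npairsS //; lia.
(* The search succeeds by [J]: the slack at [(m, J)] is zero and the opening of [t] at [m] adds at
   most one. *)
have [||Z [mZ ZJ tcZ Zmin]] := @least_from m.+1 J
  (fun b => npairs t m.+1 b <= (npairs c m.+1 b).+1) => //.
have ZY : Z <= Y.
  by rewrite leqNgt; apply/negP=> /(Zmin Y mY); lia.
pose P (k : I) := (m < k < Z) &&
  (isSome (sgn c k) || (k < mate c k) && (mate c k < Y)).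
have Zn : Z <= p + q by lia.
have sr_lt z f : m < z -> z <= Z -> (forall y : I, y < z -> ~~ P y) ->
    nsigns t f z < nsigns c f z.
  move=> mz zZ zmin; have zn : z <= p + q by lia.
  have zY : z <= Y by lia.
  have h1 (x : I) : m < x < z -> sgn c x != Some (~~ f).
    move=> /andP[mx xz]; have := zmin x xz; rewrite /P mx (leq_trans xz zZ) /=.
    by case: (sgn c x).
  have h2 (x : I) : m < x < z -> x < mate c x -> Y <= mate c x.
    move=> /andP[mx xz] xm; have := zmin x xz; rewrite /P mx (leq_trans xz zZ) /=.
    by rewrite xm /= => /norP[_]; rewrite -leqNgt.
  have := nsigns_slack ct mz zn zY tcY h1 h2; rewrite srt src; lia.
have [k0 Pk0|P0] := pickP P; last first.
  have Pf x : ~~ P x by rewrite P0.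
  have h1 (x : I) : m < x < Z -> sgn c x != Some sP.
    by move=> mx; have := Pf x; rewrite /P mx /=; case: (sgn c x).
  have h2 (x : I) : m < x < Z -> x < mate c x -> Z <= mate c x.
    move=> mx xm; have := Pf x; rewrite /P mx xm /= => /norP[_].
    by rewrite -leqNgt; exact: leq_trans.
  (* The drop estimate alone leaves slack one at [Z]; the strict sign inequality at [Z] makes it
     two, contradicting [tcZ]. *)
  have := @slack_drop _ _ c t ct sP m.+1 Z mZ Zn h1 h2.
  have := sr_lt Z sP mZ (leqnn Z) (fun y _ => Pf y).
  have := nsigns_closing_ge twf sP mZ Zn; have := nsigns_closing_le cwf mZ Zn h1 h2.
  by rewrite srt src; lia.
have [k [/andP[/andP[mk kZ] Pk] kmin]] := first_ord Pk0.
have kn := ltn_ord k.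
have h2 a : a <= k -> forall x : I, m < x < a -> x < mate c x -> Y <= mate c x.
  move=> ak x /andP[mx xa] xm; have := kmin x (leq_trans xa ak).
  by rewrite /P mx (ltn_trans (leq_trans xa ak) kZ) /= => /norP[_]; rewrite xm -leqNgt.
have Hop a b : m < a -> a <= k -> a <= b -> b <= Y ->
    npairs c a b + npairs t m.+1 b <= npairs t a b + npairs c m.+1 b.
  move=> ma ak ab bY; have an : a <= p + q by lia.
  exact (npairs_slack ct ma an ab bY tcY (h2 a ak)).
have Hsr f a : m < a -> a <= k -> nsigns t f a < nsigns c f a.
  move=> ma ak; apply: sr_lt => //; first by lia.
  by move=> y ya; apply: kmin; lia.
have HY a b : m < a -> a <= k -> a <= b -> b < Y -> npairs c a b < npairs t a b.
  move=> ma ak ab bY; have := Hop a b ma ak ab (ltnW bY).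
  by have := Ymin b (leq_trans ma ab) bY; lia.
case/orP: Pk => [|/andP[kk kmY]].
  case ck: (sgn c k) => [e|//] _.
  apply: (lift_pair_sign ct im mk mi ck) => [a b ia ab mb bk|a]; last exact: Hsr.
  have [am|ma] := leqP a m; first by apply: slack => //; lia.
  by apply: HY => //; lia.
(* The three regions are controlled by [J], [Z] and [Y] respectively, as [k < Z <= J] and
   [mate c k < Y]. *)
apply: (lift_pairs_cross ct im mk kk mi erefl) => //.
- by move=> a b ia am mb bk; apply: slack => //; lia.
- move=> a b ma ab bk; have := Hop a b ma (leq_trans ab bk) ab ltac:(lia).
  by have := Zmin b (leq_trans ma ab) ltac:(lia); lia.
- by move=> a b ma ak kb bk; apply: HY => //; lia.
Qed.

End Closing.

Lemma lift_first_difference : ~~ agree c t m -> liftable c t.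
Proof.
move=> nag; have GE := Gm (leqnn m); have mn := ltn_ord m.
have := npairsS c m m.+1; have := npairsS t m m.+1.
have := npairs_mate cwf m m; have := npairs_mate twf m m.
have := ct.1 m.+1 m.+1 (leqnn _).
have := ct.2 sP m.+1; have := ct.2 sM m.+1; rewrite !nsignsS !Sm.
(* The sign inequalities at [m.+1] rule out a sign of [c] against a closing or the opposite sign of
   [t], and an opening of [c] against anything but an opening. *)
case: (sgnP cwf m) => [[e [cs cm]]|[cs cm]|[cs cm]].
- case: (ltngtP m (mate t m)) => tm.
  + by move=> *; exact: lift_sign_open cs tm.
  + by rewrite cs cm; case: (e); lia.
  + move/val_inj/esym: tm => tm; case: (sgnP twf m) => [[f [ts _]]|[_]|[_]];
      try by rewrite tm ltnn.
    move: nag; rewrite /agree cs ts cm tm ltnn /= andbT.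
    by case: (e); case: (f) => //=; lia.
- case: (sgnP twf m) => [[f [ts tm]]|[ts tm]|[ts tm]].
  + by rewrite cs ts tm; lia.
  + by move: nag; rewrite /agree cs ts eqxx !ltnNge (ltnW cm) (ltnW tm).
  + by lia.
- move=> *; case: (sgnP twf m) => [[f [ts tm]]|[ts tm]|[ts tm]].
  + by apply: (lift_closing_sign cm _ ts); rewrite tm.
  + by apply: lift_closing_open => //; exact: ltnW.
  + apply: lift_closings => //.
    by move: nag; rewrite /agree cs ts eqxx cm tm /= eq_sym.
Qed.

End FirstDifference.

Theorem theorem2p7 (p q : nat) (gamma tau : clan p q) :
  bruhat_lt gamma tau ->
  exists gamma' : clan p q,
    [/\ bruhat_lt gamma gamma', bruhat_le gamma' tau & clan_move gamma gamma'].
Proof.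
case=> /(bruhat_leE (clan_wf gamma) (clan_wf tau)) le_gt neq.
have [x0 nag|ag] := pickP (fun x => ~~ agree gamma tau x).
  have [m [nagm agm]] := first_ord (P := fun x => ~~ agree gamma tau x) nag.
  apply: (lift_first_difference le_gt _ nagm) => x /agm.
  by rewrite negbK.
by case: neq; apply: agree_eq => x; have := ag x => /negbFE.
Qed.
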